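(* Let $G$ be a directed graph on vertex set $[n]$ and $S$ a subset of its edges, and write $$\omega\,\mathrm G_{G,S}(\mathbf x;q+1)=\sum_{\alpha\vDash n}c^{G,S}_\alpha(q)\frac{\Psi_\alpha(\mathbf x)}{z_\alpha}.$$ Then $c^{G,S}_\alpha(q)\in\mathbb N[q]$ for all compositions $\alpha$.
   Context: For a coloring $\kappa:[n]\to\mathbb Z_{>0}$, $\mathrm{asc}(\kappa)$ is the number of directed edges $(i,j)$ (with multiplicity) of $G$ with $\kappa(i)<\kappa(j)$. The vertical strip graph LLT polynomial is $\mathrm G_{G,S}(\mathbf x;q)=\sum_\kappa x_{\kappa(1)}\cdots x_{\kappa(n)}q^{\mathrm{asc}(\kappa)-|S|}$, summed over all colorings $\kappa$ with $\kappa(i)<\kappa(j)$ for every directed edge $(i,j)\in S$. $\omega$ is the linear automorphism of quasisymmetric functions with $\omega(F_{n,T})=F_{n,[n-1]\setminus(n-T)}$, where $F_{n,T}=\sum_{j_1\le\dots\le j_n,\ j_i<j_{i+1}\ (i\in T)}x_{j_1}\cdots x_{j_n}$ and $n-T=\{n-t:t\in T\}$, extended coefficientwise in $q$. For compositions: $S_\alpha=\{\alpha_1,\dots,\alpha_1+\dots+\alpha_{\ell-1}\}$, blocks $B_i(\alpha)$ consecutive intervals of sizes $\alpha_i$, $\alpha\le\beta$ iff $S_\beta\subseteq S_\alpha$; $M_\alpha=\sum_{i_1<\dots<i_\ell}x_{i_1}^{\alpha_1}\cdots x_{i_\ell}^{\alpha_\ell}$; $z_\alpha=\prod_i i^{m_i}m_i!$;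 $\pi(\gamma)=\prod_i(\gamma_1+\dots+\gamma_i)$; $\pi(\alpha,\beta)=\prod_i\pi(\alpha^{(i)})$ with $\alpha^{(i)}$ the parts of $\alpha$ whose blocks lie in $B_i(\beta)$; $\Psi_\alpha=z_\alpha\sum_{\beta\ge\alpha}\pi(\alpha,\beta)^{-1}M_\beta$. *)

(* Defs.v *)
From HB Require Import structures.
From mathcomp Require Import all_boot all_order all_algebra.
Set Implicit Arguments. Unset Strict Implicit. Unset Printing Implicit Defensive.
Import Order.TTheory GRing.Theory Num.Theory.
Local Open Scope ring_scope.

Fixpoint seqs_upto (k m : nat) : seq (seq nat) :=
  match k with
  | 0 => [:: [::]]
  | k'.+1 => [::] :: [seq x :: s | x <- iota 1 m, s <- seqs_upto k' m]
  end.

Definition is_composition (n : nat) (al : seq nat) : bool :=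
  all (fun x => 0 < x)%N al && (sumn al == n).

Definition compositions (n : nat) : seq (seq nat) :=
  [seq al <- seqs_upto n n | is_composition n al].

Definition psums (al : seq nat) : seq nat :=
  [seq sumn (take k al) | k <- iota 1 (size al).-1].

Definition comp_le (al be : seq nat) : bool :=
  all (fun s => s \in psums al) (psums be).

Definition zee (al : seq nat) : nat :=
  \prod_(i <- undup al) (i ^ count_mem i al * (count_mem i al)`!)%N.

Definition pi1 (ga : seq nat) : nat :=
  \prod_(k < size ga) sumn (take k.+1 ga).

(* alpha^(i) : parts of alpha whose blocks lie in B_i(beta)
   (blocks are the intervals (sum_{<j}, sum_{<=j}]) *)
Definition subcomp (al be : seq nat) (i : nat) : seq nat :=
  [seq nth 0%N al j | j <- iota 0 (size al) &
     (sumn (take i be) <= sumn (take j al))%N &&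
     (sumn (take j.+1 al) <= sumn (take i.+1 be))%N].

Definition pi2 (al be : seq nat) : nat :=
  \prod_(i < size be) pi1 (subcomp al be i).

(* ---------- Formal power series, homogeneous, in x_1, x_2, ... ----------
   A series is given by its coefficient function on exponent vectors:
   a = [:: a_1; ...; a_m] stands for the monomial x_1^{a_1} ... x_m^{a_m}. *)

Definition Mcoef (be : seq nat) (a : seq nat) : rat :=
  ([seq x <- a | x != 0%N] == be)%:R.

Definition Psicoef (n : nat) (al : seq nat) (a : seq nat) : rat :=
  (zee al)%:R *
  \sum_(be <- compositions n | comp_le al be) ((pi2 al be)%:R)^-1 * Mcoef be a.

(* The fundamental quasisymmetric function F_{n,T}, T \subset [n-1];
   an element k : 'I_(n.-1) of T stands for k+1 \in [n-1].
   The coefficient of x^a is 1 iff the weakly increasing word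
   j_1 <= ... <= j_n with content a satisfies j_t < j_{t+1} for t in T. *)
Definition Fcoef (n : nat) (T : {set 'I_(n.-1)}) (a : seq nat) : rat :=
  let j := flatten [seq nseq (nth 0%N a i) i.+1 | i <- iota 0 (size a)] in
  ((size j == n) && [forall k in T, nth 0%N j k < nth 0%N j k.+1]%N)%:R.

(* omega on F's: T |-> [n-1] \ (n - T) *)
Definition omega_set (n : nat) (T : {set 'I_(n.-1)}) : {set 'I_(n.-1)} :=
  ~: [set rev_ord k | k in T].

(* ---------- Vertical strip graph LLT polynomial ----------
   G : directed multigraph on [n] given as a list of edges (with multiplicity),
   S : sub-multiset of the edges.  Colour i+1 of the colouring corresponds to
   the ordinal i, so a colouring with content a has values in 'I_(size a). *)
Definition asc (n m : nat) (E : seq ('I_n * 'I_n)) (ka : {ffun 'I_n -> 'I_m}) : nat :=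
  count (fun e => ka e.1 < ka e.2)%N E.

Definition LLTcoef (n : nat) (E S : seq ('I_n * 'I_n)) (a : seq nat) : {poly rat} :=
  \sum_(ka : {ffun 'I_n -> 'I_(size a)} |
         [forall i : 'I_(size a), #|[set v | ka v == i]| == nth 0%N a i] &&
         all (fun e => ka e.1 < ka e.2)%N S)
     'X^(asc E ka - size S).

(* Main.v *)
Require Import Defs.
From HB Require Import structures.
From mathcomp Require Import all_boot all_order all_algebra.
From mathcomp Require Import zify.
Import Order.TTheory GRing.Theory Num.Theory.
Local Open Scope ring_scope.
Set Implicit Arguments. Unset Strict Implicit. Unset Printing Implicit Defensive.

(** Expanding (1 + q)^(asc - |S|) over the edges outside S writes G_{G,S}(x; q+1)
    as an N[q]-combination of strict P-partition generating functions K_T, which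
    vanish when T has a directed cycle.  On monomial coefficients omega is an
    alternating sum over refinements, so the coefficient of M_beta in omega K_T is
    a sum over chains of T-closed sets with step sizes beta of a product of local
    sums.  Each local sum is 1 for an acyclic T: peel off the first block, a
    nonempty set of sources, and use that the signed count of nonempty subsets
    of a nonempty set is 1.  So omega K_T counts weak T-partitions.

    The same count arises from Psi.  If x is a uniformly random element of a set B
    of size m, remove the predecessor-closed subset generated by x, and iterate;
    the sizes of the removed sets, read backwards, form a composition alpha of m,
    and each outcome has probability 1/pi(alpha).  So the numbers c_alpha of ordered partitions
    into blocks with a chosen generator satisfy sum_alpha c_alpha / pi(alpha) = 1
    locally, hence omega K_T = sum_alpha c_alpha Psi_alpha / z_alpha. *)

(** * Enumeration of compositions and sums over them *)

Lemma mem_seqs_upto k m s :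
  (s \in seqs_upto k m) = (size s <= k)%N && all (fun x => 0 < x <= m)%N s.
Proof.
elim: k s => [|k IH] [|x s] //=.
rewrite inE /=; apply/allpairsP/idP => [[[y t] /= [] ]|].
  by rewrite mem_iota add1n ltnS IH => ym /andP[st at_] [-> ->]; rewrite ltnS st ym.
rewrite ltnS => /and3P[st xm at_]; exists (x, s) => /=; split => //.
  by rewrite mem_iota add1n ltnS.
by rewrite IH st.
Qed.

Lemma uniq_seqs_upto k m : uniq (seqs_upto k m).
Proof.
elim: k => //= k IH; apply/andP; split; first by apply/allpairsP => -[[]] ? ? [].
by apply: allpairs_uniq => //; [exact: iota_uniq | case=> ? ? [? ?] _ _ [-> ->]].
Qed.

Lemma size_le_sumn s : all (fun x => 0 < x)%N s -> (size s <= sumn s)%N.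
Proof. by elim: s => //= x s IH /andP[x0 /IH h]; rewrite -add1n leq_add. Qed.

Lemma mem_compositions n s : (s \in compositions n) = is_composition n s.
Proof.
rewrite mem_filter mem_seqs_upto; apply: andb_idr => /andP[s0 /eqP <-].
rewrite size_le_sumn //=; apply/allP => x xs; rewrite (allP s0) //=.
elim: s xs {s0} => //= y s IH; rewrite inE => /orP[/eqP->|/IH h]; first exact: leq_addr.
exact: leq_trans h (leq_addl _ _).
Qed.

Lemma uniq_compositions n : uniq (compositions n).
Proof. exact/filter_uniq/uniq_seqs_upto. Qed.

Lemma is_composition_rev n s : is_composition n (rev s) = is_composition n s.
Proof. by rewrite /is_composition all_rev sumn_rev. Qed.

Lemma is_composition_cons n x s :
  is_composition n (x :: s) = [&& 0 < x <= n & is_composition (n - x) s]%N.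
Proof.
rewrite /is_composition /=; case: (posnP x) => //= x0.
case: (leqP x n) => [xn|nx]; first by rewrite -(eqn_add2l x (sumn s)) subnKC.
by case: eqP => [e|]; [rewrite -e ltnNge leq_addr in nx | rewrite andbF].
Qed.

Lemma is_composition_cat b n s1 s2 :
  is_composition b s1 -> is_composition n s2 -> is_composition (b + n) (s1 ++ s2).
Proof.
by move=> /andP[h1 /eqP<-] /andP[h2 /eqP<-]; rewrite /is_composition all_cat h1 h2 sumn_cat /=.
Qed.

Lemma compositions0 : compositions 0 = [:: [::]].
Proof. by []. Qed.

Section Sums.
Variable V : nmodType.
Implicit Type h : seq nat -> V.

Lemma sum_compositions_rev n h :
  \sum_(s <- compositions n) h (rev s) = \sum_(s <- compositions n) h s.
Proof.
rewrite -(big_map rev xpredT h); apply/perm_big/uniq_perm.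
- by rewrite map_inj_uniq ?uniq_compositions //; apply: inv_inj revK.
- exact: uniq_compositions.
move=> s; rewrite mem_compositions -is_composition_rev -mem_compositions.
by rewrite -{1}(revK s) (mem_map (inv_inj (@revK _))).
Qed.

Lemma sum_compositions_head n h :
  \sum_(s <- compositions n.+1) h s =
  \sum_(1 <= a < n.+2) \sum_(s <- compositions (n.+1 - a)) h (a :: s).
Proof.
rewrite /index_iota subSS subn0.
pose L := [seq a :: s | a <- iota 1 n.+1, s <- compositions (n.+1 - a)].
rewrite (_ : \sum_(a <- _) _ = \sum_(s <- L) h s); last first.
  by rewrite [RHS]big_flatten big_map; apply: eq_bigr => a _; rewrite big_map.
apply/perm_big/uniq_perm; first exact: uniq_compositions.
  apply: allpairs_uniq_dep; first exact: iota_uniq.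
    by move=> ? _; apply: uniq_compositions.
  by case=> ? ? [? ?] _ _ [-> ->].
move=> s; rewrite mem_compositions.
apply/idP/allpairsPdep => [|[a [t [ha ht ->]]]].
  case: s => [|a t]; rewrite ?is_composition_cons // => /andP[ha ht].
  by exists a, t; rewrite mem_iota add1n ltnS mem_compositions; split.
by move: ha ht; rewrite mem_iota add1n ltnS mem_compositions is_composition_cons => -> ->.
Qed.

Definition incr_head (s : seq nat) := (head 0 s).+1%N :: behead s.

(** A composition of n + 2 begins with 1 or with a larger part; dropping that 1, or lowering that
    part by one, leaves a composition of n + 1. *)
Lemma sum_compositions_incr n h :
  \sum_(s <- compositions n.+2) h s =
  \sum_(s <- compositions n.+1) (h (1%N :: s) + h (incr_head s)).
Proof.
rewrite big_split /= -(big_map (cons 1%N) xpredT h) -(big_map incr_head xpredT h) -big_cat.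
have nnil t : t \in compositions n.+1 -> t = head 0%N t :: behead t.
  by rewrite mem_compositions; case: t.
have nhead t : t \in compositions n.+1 -> (0 < head 0 t)%N.
  by rewrite mem_compositions; case: t => //= x t; rewrite /is_composition /= => /andP[/andP[]].
apply/perm_big/uniq_perm; first exact: uniq_compositions.
  rewrite cat_uniq map_inj_uniq ?uniq_compositions //=; last by move=> ? ? [].
  apply/andP; split.
    apply/hasPn => _ /mapP[t ht ->]; apply/mapP => -[u _ [e _]].
    by move: (nhead _ ht); rewrite e.
  rewrite map_inj_in_uniq ?uniq_compositions // => t u /nnil ht /nnil hu [e1 e2].
  by rewrite ht hu e1 e2.
move=> s; rewrite mem_cat; apply/idP/orP => [|[] /mapP[t ht ->]]; rewrite mem_compositions.
- case: s => [|[|[|a]] t] // ht; first by left; rewrite map_f // mem_compositions.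
  by right; apply/mapP; exists (a.+1 :: t); rewrite // mem_compositions.
- by move: ht; rewrite mem_compositions.
by move: (nnil _ ht) (ht) => {1 2}->; rewrite mem_compositions /is_composition /= => /andP[/andP[_ ->]].
Qed.

End Sums.

(** * Ordered set partitions with predecessor-closed steps *)

Section OrderedPartitions.
Variables (T : finType) (r : rel T).
Implicit Types (w : {set T} -> rat) (A B R : {set T}) (s t : seq nat).

Definition pred_closed R A := [forall u in R, forall v in A, r u v ==> (u \in A)].

Lemma pred_closedP R A :
  reflect (forall u v, u \in R -> v \in A -> r u v -> u \in A) (pred_closed R A).
Proof.
apply: (iffP forall_inP) => [h u v /h /forall_inP h' /h' /implyP //|h u uR].
by apply/forall_inP => v vA; apply/implyP; apply: h.
Qed.

(** Sum over ordered set partitions of [R] with block sizes [s], each block predecessor-closed in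
    what is left, of the product of the block weights. Zero parts are allowed, so [s] may also be an
    exponent vector. *)
Fixpoint peel w s R : rat :=
  if s is a :: s' then
    \sum_(A : {set T} | [&& A \subset R, pred_closed R A & #|A| == a])
       w A * peel w s' (R :\: A)
  else (R == set0)%:R.

(** Cut the chain after its first [size s] blocks: their union [B] is predecessor-closed in [R], and
    the later blocks partition [R :\: B]. *)
Lemma peel_cat w s t R :
  peel w (s ++ t) R =
  \sum_(B : {set T} | [&& B \subset R, pred_closed R B & #|B| == sumn s])
     peel w s B * peel w t (R :\: B).
Proof.
elim: s R => [|a s IH] R /=.
  rewrite (big_pred1 set0) ?eqxx ?mul1r ?setD0 // => B /=.
  rewrite cards_eq0; case: eqP => [->|]; rewrite ?andbF // sub0set.
  by apply/and3P; split=> //; apply/pred_closedP => u v _; rewrite inE.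
under eq_bigr => A _ do rewrite IH big_distrr /=.
under [RHS]eq_bigr => B _ do rewrite big_distrl /=.
rewrite [RHS](exchange_big_dep (fun A : {set T} =>
  [&& A \subset R, pred_closed R A & #|A| == a])) /=; last first.
  move=> B A /and3P[BR cB _] /and3P[AB cA ->].
  rewrite (subset_trans AB BR) andbT; apply/pred_closedP => u v uR vA ruv.
  apply: (pred_closedP _ _ cA u v _ vA ruv).
  exact: (pred_closedP _ _ cB u v uR (subsetP AB v vA) ruv).
apply: eq_bigr => A /and3P[AR cA /eqP cardA].
have dA B' : B' \subset R :\: A -> (A :|: B') :\: A = B'.
  move=> /subsetP h; apply/setP => x; rewrite !inE; case: (boolP (x \in A)) => //= xA.
  by apply/esym/negbTE/negP => /h; rewrite inE xA.
(* With the first block [A] fixed, [B] is encoded by [B' = B :\: A]. *)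
rewrite [RHS](reindex_onto (fun B' => A :|: B') (fun B => B :\: A)) /=; last first.
  by move=> B /andP[_ /and3P[AB _ _]]; apply/setP => x; rewrite !inE;
     case: (boolP (x \in A)) => //= /(subsetP AB) ->.
apply: eq_big => [B'|B' /and3P[h _ _]]; last by rewrite dA // setDDl mulrA.
apply/and3P/andP => [[sB cB /eqP sz]|[/andP[/and3P[sU cU /eqP sz] _] /eqP e]].
  rewrite dA // subsetUl subUset AR (subset_trans sB (subsetDl _ _)) cardsU cardA sz.
  have -> : A :&: B' = set0.
    apply/setP => x; rewrite !inE; apply/andP => -[xA /(subsetP sB)].
    by rewrite inE xA.
  rewrite cards0 subn0 !eqxx /= !andbT; split=> //; apply/andP; split; apply/pred_closedP => u v.
    move=> uR; rewrite !inE => /orP[vA ruv|vB ruv].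
      by rewrite (pred_closedP _ _ cA u v uR vA ruv).
    case: (boolP (u \in A)) => //= uA.
    by apply: (pred_closedP _ _ cB u v _ vB ruv); rewrite inE uA.
  rewrite !inE => uU vA ruv; apply: (pred_closedP _ _ cA u v _ vA ruv).
  by case/orP: uU => [/(subsetP AR)//|/(subsetP sB)]; rewrite inE => /andP[].
have sB : B' \subset R :\: A by rewrite -e; apply: setSD.
split=> //.
  apply/pred_closedP => u v; rewrite inE => /andP[uA uR] vB ruv.
  have := pred_closedP _ _ cU u v uR; rewrite !inE vB orbT (negPf uA) /=; exact.
have /eqP := sz; rewrite cardsU cardA.
have -> : A :&: B' = set0.
  apply/setP => x; rewrite !inE; apply/andP => -[xA /(subsetP sB)].
  by rewrite inE xA.
by rewrite cards0 subn0 eqn_add2l.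
Qed.

Lemma peel_weight1_single B b : #|B| = b -> peel (fun=> 1) [:: b] B = 1.
Proof.
move=> cB /=; rewrite (big_pred1 B) ?mul1r ?setDv ?eqxx // => A /=.
apply/and3P/eqP => [[AB _ /eqP cA]|->]; first by apply/eqP; rewrite eqEcard AB cA cB /=.
by split; rewrite ?cB //; apply/pred_closedP.
Qed.

End OrderedPartitions.

(** * Refinements, and the passage from a local identity to a global one *)

Fixpoint refinements (be : seq nat) : seq (seq nat) :=
  if be is b :: be' then
    [seq s ++ t | s <- compositions b, t <- refinements be']
  else [:: [::]].

Lemma sum_refinements_cons (V : nmodType) b be (h : seq nat -> V) :
  \sum_(al <- refinements (b :: be)) h al =
  \sum_(s <- compositions b) \sum_(t <- refinements be) h (s ++ t).
Proof. by rewrite big_flatten /= big_map; apply: eq_bigr => a _; rewrite big_map. Qed.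

Lemma refinements_composition be al :
  al \in refinements be -> is_composition (sumn be) al.
Proof.
elim: be al => [|b be IH] al /=; first by rewrite inE => /eqP ->.
case/allpairsP => -[s t] /= []; rewrite mem_compositions => hs /IH ht ->.
exact: is_composition_cat.
Qed.

Section Aggregate.
Variables (T : finType) (r : rel T) (w : {set T} -> rat) (u : seq nat -> rat).
Hypothesis sum1 : forall B : {set T},
  \sum_(s <- compositions #|B|) u s * peel r w (rev s) B = 1.
Variable U : seq nat -> seq nat -> rat.
Hypothesis U0 : U [::] [::] = 1.
Hypothesis UM : forall b be s t, s \in compositions b -> t \in refinements be ->
  U (b :: be) (s ++ t) = u s * U be t.

Lemma sum_refinements_peel be (R : {set T}) : #|R| = sumn be ->
  \sum_(al <- refinements be) U be al * peel r w (rev al) R =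
  peel r (fun=> 1) (rev be) R.
Proof.
elim: be R => [|b be IH] R cR; first by rewrite /= big_seq1 U0 mul1r.
rewrite sum_refinements_cons rev_cons -cats1 peel_cat.
transitivity (\sum_(s <- compositions b) \sum_(t <- refinements be)
    \sum_(B : {set T} | [&& B \subset R, pred_closed r R B & #|B| == sumn be])
   (u s * peel r w (rev s) (R :\: B)) * (U be t * peel r w (rev t) B)).
  rewrite big_seq [RHS]big_seq; apply: eq_bigr => s hs.
  rewrite big_seq [RHS]big_seq; apply: eq_bigr => t ht.
  rewrite UM // rev_cat peel_cat big_distrr /= sumn_rev.
  have /andP[_ /eqP ->] := refinements_composition ht.
  by apply: eq_bigr => B _; rewrite [X in _ * X]mulrC mulrACA.
under eq_bigr => s _ do rewrite exchange_big /=.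
rewrite exchange_big sumn_rev; apply: eq_bigr => B /and3P[BR _ /eqP cB].
have cD : #|R :\: B| = b by rewrite cardsD (setIidPr BR) cR cB addnK.
rewrite (peel_weight1_single _ cD) mulr1 -(IH _ cB).
under eq_bigr => s _ do rewrite -mulr_sumr.
by rewrite -mulr_suml -{1}cD sum1 mul1r.
Qed.

End Aggregate.

(** * The two local identities: signed independent blocks and chosen generators *)

Lemma pi1_rcons s a : pi1 (rcons s a) = (pi1 s * (sumn s + a))%N.
Proof.
rewrite /pi1 size_rcons big_ord_recr /= -{1}(size_rcons s a) take_size sumn_rcons.
congr (_ * _)%N; apply: eq_bigr => k _.
by rewrite -cats1 takel_cat.
Qed.

Lemma pi1_neq0 s : all (fun x => 0 < x)%N s -> pi1 s != 0%N.
Proof.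
elim/last_ind: s => [|s a IH]; first by rewrite /pi1 big_ord0.
by rewrite all_rcons pi1_rcons muln_eq0 => /andP[a0 /IH /negPf ->]; rewrite addn_eq0 negb_and (gtn_eqF a0) orbT.
Qed.

Section Weights.
Variables (T : finType) (r : rel T).
Implicit Types (A B R : {set T}) (s t : seq nat).
Local Notation pred_closed := (pred_closed r).

Definition independent A := [forall u in A, forall v in A, ~~ r u v].
Definition strict_weight A : rat := (independent A)%:R.

(** Equivalently, [x] lies in [A] and every element of [A] reaches [x] by a directed path inside
    [A]. *)
Definition generates A x :=
  (x \in A) && [forall A' : {set T}, [&& A' \subset A, pred_closed A A' & x \in A'] ==> (A' == A)].
Definition gen_weight A : rat := #|[set x | generates A x]|%:R.

(** On a finite set this is the absence of directed cycles, loops included, phrased as the existence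
    of sources. *)
Definition acyclic := [forall R : {set T}, (R != set0) ==>
  [exists v in R, forall u in R, ~~ r u v]].

Lemma sum_by_card (P : pred {set T}) (F : {set T} -> rat) N :
  (forall A, P A -> #|A| <= N)%N ->
  \sum_(1 <= a < N.+1) \sum_(A : {set T} | P A && (#|A| == a)) F A =
  \sum_(A : {set T} | P A && (A != set0)) F A.
Proof.
move=> hN; rewrite (exchange_big_dep P) => [|a A _ /andP[]] //=.
rewrite [RHS]big_mkcondr; apply: eq_bigr => A PA.
under eq_bigl => a do rewrite PA eq_sym /=.
by rewrite big_nat1_eq ltnS hN // andbT card_gt0.
Qed.

(** Toggling a fixed [x] of [M] pairs subsets of opposite sign, so the sum over all subsets is 0;
    the empty set makes the difference. *)
Lemma sum_sign_nonempty_subsets (M : {set T}) : M != set0 ->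
  \sum_(A : {set T} | (A \subset M) && (A != set0)) (-1) ^+ #|A|.+1 = 1 :> rat.
Proof.
case/set0Pn => x xM.
suff h : \sum_(A : {set T} | A \subset M) (-1) ^+ #|A| = 0 :> rat.
  move: h; rewrite (bigD1 set0) ?sub0set //= cards0 expr0 => /eqP.
  rewrite addrC addr_eq0 => /eqP h.
  by under eq_bigr => A _ do rewrite exprS mulN1r; rewrite sumrN h opprK.
rewrite (bigID (fun A : {set T} => x \in A)) /=.
rewrite (reindex_onto (fun A => x |: A) (fun A => A :\ x)) /=; last first.
  by move=> A /andP[_ xA]; rewrite setD1K.
apply/eqP; rewrite addrC addr_eq0 -sumrN; apply/eqP/eq_big => [A|A].
  rewrite subUset sub1set xM setU11 /= andbT; congr (_ && _).
  apply/idP/eqP => [xA|<-]; last by rewrite !inE eqxx.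
  by rewrite setU1K.
by move=> /andP[_ xA]; rewrite cardsU1 xA /= exprS mulN1r opprK.
Qed.

(** The first removed block is a nonempty set of sources of [B]. What remains contributes 1 by
    induction, which leaves the signed count of nonempty subsets of the set [M] of sources. *)
Lemma strict_weight_sum1 : acyclic -> forall B,
  \sum_(s <- compositions #|B|) (-1) ^+ (sumn s + size s) * peel r strict_weight (rev s) B = 1.
Proof.
move=> acy B.
rewrite -sum_compositions_rev; under eq_bigr => s _ do rewrite revK sumn_rev size_rev.
move: {2}(#|B|) (leqnn #|B|) => m; elim: m B => [|m IH] B.
  by rewrite leqn0 => /eqP/cards0_eq ->; rewrite cards0 compositions0 big_seq1 /= eqxx mulr1.
rewrite leq_eqVlt ltnS => /orP[/eqP cB|]; last exact: IH.
have B0 : B != set0 by rewrite -card_gt0 cB.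
pose M := [set v in B | [forall u in B, ~~ r u v]].
have M0 : M != set0.
  have /forallP/(_ B)/implyP/(_ B0)/exists_inP[v vB hv] := acy.
  by apply/set0Pn; exists v; rewrite inE vB.
(* A predecessor in [B] of an element of a closed [A] would lie in [A], against independence; so
   such an [A] consists of sources. *)
have MP A : A \subset M = [&& A \subset B, pred_closed B A & independent A].
  apply/subsetP/and3P => [h|[AB cA iA] v vA].
    have AB : A \subset B by apply/subsetP => v /h; rewrite inE => /andP[].
    have hr u v : u \in B -> v \in A -> r u v = false.
      by move=> uB /h; rewrite inE => /andP[_ /forall_inP /(_ u uB) /negbTE].
    split=> //; first by apply/pred_closedP => u v uB vA; rewrite hr.
    by apply/forall_inP => u uA; apply/forall_inP => v vA; rewrite hr // (subsetP AB).
  rewrite inE (subsetP AB) //=; apply/forall_inP => u uB; apply/negP => ruv.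
  have uA := pred_closedP _ _ _ cA u v uB vA ruv.
  by move/forall_inP/(_ u uA)/forall_inP/(_ v vA): iA; rewrite ruv.
rewrite cB sum_compositions_head -[RHS](sum_sign_nonempty_subsets M0).
transitivity (\sum_(1 <= a < m.+2) \sum_(A : {set T} | [&& A \subset B, pred_closed B A & #|A| == a])
    (-1) ^+ #|A|.+1 * strict_weight A).
  rewrite big_nat_cond [RHS]big_nat_cond; apply: eq_bigr => a /andP[/andP[a0 am] _].
  rewrite big_seq; under eq_bigr => s _ do rewrite /= mulr_sumr.
  rewrite -big_seq exchange_big /=; apply: eq_bigr => A /and3P[AB _ /eqP cA].
  have cD : #|B :\: A| = (m.+1 - a)%N by rewrite cardsD (setIidPr AB) cB cA.
  have /IH : (#|B :\: A| <= m)%N by rewrite cD; case: (a) a0 => // a' _; rewrite subSS leq_subr.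
  rewrite cD => IHD; rewrite -[RHS]mulr1 -[X in _ = _ * X]IHD.
  rewrite mulr_sumr; apply: eq_bigr => s _.
  by rewrite cA mulrACA -exprD addSn addnS addnA.
under eq_bigr => a _ do under eq_bigl => A do rewrite andbA.
rewrite sum_by_card => [|A /andP[AB _]]; last by rewrite -cB subset_leq_card.
rewrite big_mkcond [RHS]big_mkcond; apply: eq_bigr => A _; rewrite MP /strict_weight.
by case: (A \subset B); case: (pred_closed B A); case: (A != set0); case: independent; rewrite /= ?mulr1 ?mulr0.
Qed.

(** The first removed block is the last part of [s], so it puts the factor #|B| into pi(s); the rest
    sums to 1 by induction. It remains to count pairs of a predecessor-closed subset and a
    generator: there are #|B|, one for each [x] in [B]. *)
Lemma gen_weight_sum1 B :
  \sum_(s <- compositions #|B|) (pi1 s)%:R^-1 * peel r gen_weight (rev s) B = 1.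
Proof.
rewrite -sum_compositions_rev; under eq_bigr => s _ do rewrite revK.
move: {2}(#|B|) (leqnn #|B|) => m; elim: m B => [|m IH] B.
  by rewrite leqn0 => /eqP/cards0_eq ->; rewrite cards0 compositions0 big_seq1 /pi1 big_ord0 /= eqxx invr1 mulr1.
rewrite leq_eqVlt ltnS => /orP[/eqP cB|]; last exact: IH.
have cB0 : (#|B|%:R : rat) != 0 by rewrite cB pnatr_eq0.
(* The least predecessor-closed subset of [B] containing [x], hence the only one that [x]
   generates. *)
pose gen_by x := \bigcap_(A : {set T} | [&& A \subset B, pred_closed B A & x \in A]) A.
have gen_min x A : [&& A \subset B, pred_closed B A & x \in A] -> gen_by x \subset A.
  by move=> hA; apply/subsetP => y /bigcapP; apply.
have gen_byP x A : x \in B ->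
    [&& A \subset B, pred_closed B A & generates A x] = (A == gen_by x).
  move=> xB; apply/and3P/eqP => [[AB cA /andP[xA /forallP gA]]|->].
    apply/eqP; rewrite eq_sym eqEsubset; apply/andP; split.
      by apply: gen_min; rewrite AB cA.
    apply/bigcapsP => A' /and3P[A'B cA' xA'].
    suff /eqP <- : A :&: A' == A by apply: subsetIr.
    apply: (implyP (gA _)); rewrite subsetIl !inE xA xA' !andbT; apply/pred_closedP => u v uA.
    rewrite !inE uA => /andP[_ vA']; exact: (pred_closedP _ _ _ cA' u v (subsetP AB u uA)).
  move=> {A}; have BB : [&& B \subset B, pred_closed B B & x \in B].
    by rewrite subxx xB andbT; apply/pred_closedP.
  have gB : gen_by x \subset B by apply: gen_min.
  have cg : pred_closed B (gen_by x).
    apply/pred_closedP => u v uB /bigcapP vg ruv; apply/bigcapP => A hA.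
    by have /and3P[_ cA _] := hA; apply: (pred_closedP _ _ _ cA u v uB (vg A hA)).
  split=> //; apply/andP; split; first by apply/bigcapP => A /and3P[].
  apply/forallP => A'; apply/implyP => /and3P[sA' cA' xA'].
  rewrite eqEsubset sA' /=; apply: gen_min; rewrite xA' (subset_trans sA' gB) andbT.
  apply/pred_closedP => u v uB vA' ruv; apply: (pred_closedP _ _ _ cA' u v) => //.
  exact: (pred_closedP _ _ _ cg u v uB (subsetP sA' _ vA')).
rewrite cB sum_compositions_head.
transitivity (\sum_(1 <= a < m.+2) \sum_(A : {set T} | [&& A \subset B, pred_closed B A & #|A| == a])
    #|B|%:R^-1 * gen_weight A).
  rewrite big_nat_cond [RHS]big_nat_cond; apply: eq_bigr => a /andP[/andP[a0 am] _].
  rewrite big_seq; under eq_bigr => s _ do rewrite /= mulr_sumr.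
  rewrite -big_seq exchange_big /=; apply: eq_bigr => A /and3P[AB _ /eqP cA].
  have cD : #|B :\: A| = (m.+1 - a)%N by rewrite cardsD (setIidPr AB) cB cA.
  have /IH : (#|B :\: A| <= m)%N by rewrite cD; case: (a) a0 => // a' _; rewrite subSS leq_subr.
  rewrite cD => IHD; rewrite -[RHS]mulr1 -[X in _ = _ * X]IHD.
  rewrite mulr_sumr big_seq [RHS]big_seq; apply: eq_bigr => s.
  rewrite mem_compositions => /andP[_ /eqP hs].
  rewrite rev_cons pi1_rcons sumn_rev hs subnK // cB natrM invfM.
  by rewrite [X in X * _]mulrC mulrACA.
under eq_bigr => a _ do under eq_bigl => A do rewrite andbA.
rewrite sum_by_card => [|A /andP[AB _]]; last by rewrite -cB subset_leq_card.
rewrite -mulr_sumr; apply: (mulfI cB0); rewrite mulVKf // mulr1.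
transitivity (\sum_(A : {set T}) \sum_(x in B)
   ([&& A \subset B, pred_closed B A & generates A x] : nat)%:R : rat).
  rewrite big_mkcond; apply: eq_bigr => A _; rewrite -natr_sum.
  case: ifP => [/andP[/andP[AB cA] _]|].
    rewrite AB cA /=; congr _%:R; rewrite -sum1_card big_mkcond [RHS]big_mkcond /=.
    apply: eq_bigr => x _; rewrite inE /generates; case: (boolP (x \in A)) => [/(subsetP AB) ->|_] /=.
      by case: [forall _, _].
    by rewrite if_same.
  move=> h; rewrite big1 // => x xB; apply/eqP; rewrite eqb0; apply/negP => /and3P[AB cA /andP[xA _]].
  by move: h; rewrite AB cA /=; case: eqP xA => // ->; rewrite inE.
rewrite exchange_big /= -sum1_card natr_sum; apply: eq_bigr => x xB.
rewrite (bigD1 (gen_by x)) //= gen_byP // eqxx big1 ?addr0 // => A.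
by rewrite gen_byP // => /negbTE ->.
Qed.

End Weights.

(** * Monomial coefficients of fundamental quasisymmetric functions, and omega *)

(* [t k] stands for [k + 1 \in T] *)
Fixpoint descents_ok (t : pred nat) (al : seq nat) : bool :=
  if al is a :: al' then
    all (fun k => ~~ t k) (iota 0 a.-1) && descents_ok (fun k => t (a + k)%N) al'
  else true.

Lemma eq_descents_ok t t' al : t =1 t' -> descents_ok t al = descents_ok t' al.
Proof.
elim: al t t' => //= a al IH t t' tt'; congr (_ && _); first by apply: eq_all => k; rewrite tt'.
by apply: IH => k; apply: tt'.
Qed.

Lemma descents_ok_cat t s1 s2 :
  descents_ok t (s1 ++ s2) =
  descents_ok t s1 && descents_ok (fun k => t (sumn s1 + k)%N) s2.
Proof.
elim: s1 t => [|a s1 IH] t //=.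
by rewrite IH andbA; congr (_ && _); apply: eq_descents_ok => k; rewrite addnA.
Qed.

(** The weakly increasing word with content [al] and letters from [c + 1] on. [Fcoef] uses [c = 0];
    the offset serves the induction. *)
Definition word c (al : seq nat) := flatten [seq nseq (nth 0%N al i) (c + i).+1 | i <- iota 0 (size al)].

Lemma word_cons c a al : word c (a :: al) = nseq a c.+1 ++ word c.+1 al.
Proof.
rewrite /word /= addn0; congr (_ ++ flatten _).
rewrite (iotaDl 1 0) -map_comp; apply: eq_map => i /=.
by rewrite add1n addSnnS.
Qed.

Lemma size_word c al : size (word c al) = sumn al.
Proof. by elim: al c => [|a al IH] c //; rewrite word_cons size_cat size_nseq IH. Qed.

Lemma descents_okP (t : pred nat) al c : all (fun x => 0 < x)%N al ->
  reflect (forall k, (k.+1 < sumn al)%N -> t k ->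
             (nth 0 (word c al) k < nth 0 (word c al) k.+1)%N)
          (descents_ok t al).
Proof.
elim: al c t => [|a al IH] c t /=; first by move=> _; constructor => k.
case/andP => a0 al0; rewrite word_cons.
apply: (iffP andP) => [[/allP h1 /(IH c.+1 _ al0) h2] k|h].
  rewrite !nth_cat size_nseq => ks tk.
  have ak : (a <= k.+1)%N.
    rewrite leqNgt; apply/negP => ka; have := h1 k; rewrite tk /= => /(_ _)/negP; case=> //.
    by rewrite mem_iota; lia.
  move: ak; rewrite leq_eqVlt => /orP[/eqP ak|ak]; last first.
    have [ak1 ak2]: (k < a)%N = false /\ (k.+1 < a)%N = false by lia.
    rewrite ak1 ak2 subSn; last by lia.
    by apply: h2; [lia | rewrite subnKC //; lia].
  (* Here [k] is the last position of the first block; the next part is positive, so the next letter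
     is larger. *)
  have ka : (k < a)%N by lia.
  rewrite ka -ak ltnn subnn nth_nseq ka.
  case: al ks al0 {IH h2} => [|[|b] al] //=; first by lia.
  by rewrite addn0.
split.
  apply/allP => k; rewrite mem_iota /= add0n => ka; apply/negP => tk.
  have := h k _ tk; rewrite !nth_cat size_nseq !nth_nseq.
  have [-> ->]: (k < a)%N /\ (k.+1 < a)%N by lia.
  by rewrite ltnn => /(_ _)/negP; case=> //; lia.
apply/(IH c.+1 _ al0) => k kal tk.
have := h (a + k)%N _ tk; rewrite !nth_cat size_nseq.
have [-> ->]: (a + k < a)%N = false /\ ((a + k).+1 < a)%N = false by lia.
by rewrite subSn ?leq_addr // addKn; apply; lia.
Qed.

Definition set_pred n (A : {set 'I_n}) (k : nat) : bool := [exists i in A, val i == k].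

Lemma set_predP n (A : {set 'I_n}) (i : 'I_n) : set_pred A i = (i \in A).
Proof.
apply/exists_inP/idP => [[j jA /eqP/val_inj <-] //|iA]; by exists i.
Qed.

Lemma Fcoef_descents_ok n (A : {set 'I_(n.-1)}) al : is_composition n al ->
  Fcoef A al = (descents_ok (set_pred A) al)%:R.
Proof.
case/andP => al0 /eqP sal; rewrite /Fcoef.
have -> : flatten [seq nseq (nth 0%N al i) i.+1 | i <- iota 0 (size al)] = word 0 al.
  by rewrite /word; congr flatten; apply: eq_map => i.
rewrite size_word sal eqxx /=; congr (nat_of_bool _)%:R.
apply/forall_inP/(descents_okP _ 0 al0) => [h k kn /exists_inP[i iA /eqP <-]|h i iA].
  exact: h.
by apply: h; [rewrite sal; have := ltn_ord i; lia | rewrite set_predP].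
Qed.

(** Index [i] stands for position [i + 1] and reversal sends position p to n - p, whence the shift
    by 2 in the hypothesis. *)
Lemma descents_ok_rev t t' al :
  all (fun x => 0 < x)%N al ->
  (forall i j, (i + j).+2 = sumn al -> t i = t' j) ->
  descents_ok t (rev al) = descents_ok t' al.
Proof.
elim: al t t' => //= a al IH t t' /andP[a0 al0] tt'.
rewrite rev_cons -cats1 descents_ok_cat sumn_rev /= andbT andbC; congr (_ && _).
  apply/allP/allP => h k; rewrite mem_iota /= add0n => ka.
    rewrite -(tt' (sumn al + (a.-2 - k))%N k); last by lia.
    by apply: h; rewrite mem_iota; lia.
  rewrite (tt' _ (a.-2 - k)%N); last by lia.
  by apply: h; rewrite mem_iota; lia.
by apply: IH => // i j ij; apply: tt'; lia.
Qed.

Lemma Fcoef_rev n (A : {set 'I_(n.-1)}) al : is_composition n al ->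
  Fcoef A (rev al) = Fcoef [set rev_ord k | k in A] al.
Proof.
move=> hal; rewrite !Fcoef_descents_ok ?is_composition_rev //.
case/andP: hal => al0 /eqP sal; congr (nat_of_bool _)%:R.
apply: descents_ok_rev => // i j; rewrite sal => ij.
have hi : (i < n.-1)%N by lia.
have hj : (j < n.-1)%N by lia.
rewrite -[i]/(val (Ordinal hi)) -[j]/(val (Ordinal hj)) !set_predP.
rewrite (_ : Ordinal hj = rev_ord (Ordinal hi)); last by apply: val_inj => /=; lia.
by rewrite mem_imset //; apply: rev_ord_inj.
Qed.

(** The sign (-1)^(|al| - l(al)), with a sum in the exponent to avoid truncated subtraction. *)
Definition sign_of (al : seq nat) : rat := (-1) ^+ (sumn al + size al).

Lemma sign_of_cat s t : sign_of (s ++ t) = sign_of s * sign_of t.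
Proof. by rewrite /sign_of sumn_cat size_cat addnACA exprD. Qed.

(** Inclusion-exclusion: over the sets S with T inside S inside [b-1], the signs (-1)^(b-1-|S|) add
    up to 1 if T = [b-1] and to 0 otherwise. *)
Lemma sum_sign_descents_ok b t :
  \sum_(s <- compositions b) sign_of s * (descents_ok t s)%:R =
  (all t (iota 0 b.-1))%:R.
Proof.
case: b => [|b]; first by rewrite compositions0 big_seq1 /sign_of /= mul1r.
elim: b t => [|b IH] t.
  by rewrite (_ : compositions 1 = [:: [:: 1%N]]) // big_seq1 /sign_of /= expr2 mulrNN !mul1r.
rewrite sum_compositions_incr (_ : iota 0 _ = 0%N :: map succn (iota 0 b)); last by rewrite -(iotaDl 1 0 b).
(* Prefixing 1 keeps the sign; enlarging the first part flips it and requires that [t 0] fail. So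
   the two terms cancel unless [t 0] holds. *)
transitivity (\sum_(s <- compositions b.+1)
   (t 0)%:R * (sign_of s * (descents_ok (fun k => t k.+1) s)%:R)).
  rewrite big_seq [RHS]big_seq; apply: eq_bigr => s; rewrite mem_compositions.
  case: s => [|a s] //; rewrite is_composition_cons => /andP[/andP[a0 _] _].
  rewrite /incr_head /sign_of; case: a a0 => // a _.
  rewrite (_ : sumn _ + _ = (sumn (a.+1 :: s) + size (a.+1 :: s)).+2)%N; last by rewrite /= ; lia.
  rewrite (_ : sumn (_ :: behead _) + _ = (sumn (a.+1 :: s) + size (a.+1 :: s)).+1)%N; last by rewrite /= ; lia.
  rewrite /= (iotaDl 1 0 a) all_map /= !exprS.
  set e := (-1) ^+ _; set X := (X in (~~ _ && X) && _).
  rewrite (@eq_descents_ok (fun k => t (a.+2 + k)%N) (fun k => t (a.+1 + k).+1)) //.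
  rewrite -[all (fun k => ~~ t (1 + k)%N) _]/X.
  by case: (t 0%N); case: X; case: descents_ok; rewrite /= ?mulr1 ?mulr0 ?mulN1r ?opprK ?addr0 ?add0r ?addNr ?mul0r ?mul1r ?subrr.
by rewrite -mulr_sumr IH /= all_map; case: (t 0%N); rewrite ?mul1r ?mul0r.
Qed.

Lemma sum_refinements_descents_ok be t :
  \sum_(al <- refinements be) sign_of al * (descents_ok t al)%:R =
  (descents_ok (predC t) be)%:R.
Proof.
elim: be t => [|b be IH] t; first by rewrite big_seq1 /sign_of /= mulr1.
rewrite sum_refinements_cons.
transitivity (\sum_(s <- compositions b) sign_of s * (descents_ok t s)%:R *
   (descents_ok (predC (fun k => t (b + k)%N)) be)%:R).
  rewrite big_seq [RHS]big_seq; apply: eq_bigr => s; rewrite mem_compositions => /andP[_ /eqP sb].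
  rewrite -IH mulr_sumr; apply: eq_bigr => u _.
  by rewrite sign_of_cat descents_ok_cat sb -mulnb natrM mulrACA.
rewrite -mulr_suml sum_sign_descents_ok /= -natrM mulnb; congr (nat_of_bool (_ && _))%:R.
by apply: eq_all => k /=; rewrite negbK.
Qed.

(** Reversing [al] turns T into n - T, and the alternating sum over refinements complements that
    set. *)
Lemma Fcoef_omega n (A : {set 'I_(n.-1)}) be : is_composition n be ->
  Fcoef (omega_set A) be = \sum_(al <- refinements be) sign_of al * Fcoef A (rev al).
Proof.
move=> hbe; rewrite Fcoef_descents_ok //.
pose B := [set rev_ord k | k in A].
transitivity ((descents_ok (predC (set_pred B)) be)%:R : rat).
  case/andP: hbe => be0 /eqP sbe; congr (nat_of_bool _)%:R.
  have okP t := descents_okP t 0 be0.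
  apply/okP/okP => h k kn.
    move=> /= hk; apply: h => //; have hn : (k < n.-1)%N by rewrite sbe in kn; lia.
    by move: hk; rewrite -[k]/(val (Ordinal hn)) !set_predP inE.
  move=> hk; apply: h => //=; have hn : (k < n.-1)%N by rewrite sbe in kn; lia.
  by move: hk; rewrite -[k]/(val (Ordinal hn)) !set_predP inE.
rewrite -sum_refinements_descents_ok big_seq [RHS]big_seq; apply: eq_bigr => al /refinements_composition.
by case/andP: hbe => _ /eqP -> hal; rewrite Fcoef_rev // Fcoef_descents_ok.
Qed.

(** * The refinement order, the products pi(alpha, beta) and triangularity *)

Lemma sumn_take_le s k : (sumn (take k s) <= sumn s)%N.
Proof. by rewrite -{2}(cat_take_drop k s) sumn_cat leq_addr. Qed.

Lemma sumn_take_lt s k : all (fun x => 0 < x)%N s -> (k < size s)%N ->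
  (sumn (take k s) < sumn s)%N.
Proof.
move=> s0 ks; rewrite -{2}(cat_take_drop k s) sumn_cat -[X in (X < _)%N]addn0 ltn_add2l.
rewrite (drop_nth 0%N ks) /= addn_gt0 (allP s0) //; exact: mem_nth.
Qed.

(** The parts of [s] fill the first block, and each part of [t], being positive, ends beyond [b]. *)
Lemma subcomp_cons_0 s t b be :
  is_composition b s -> all (fun x => 0 < x)%N t ->
  subcomp (s ++ t) (b :: be) 0 = s.
Proof.
case/andP => s0 /eqP sb t0; rewrite /subcomp /= take0 addn0 size_cat iotaD filter_cat map_cat.
rewrite (eq_in_filter (a2 := predT)) ?filter_predT; last first.
  move=> j; rewrite mem_iota add0n => /= js; rewrite takel_cat //.
  by rewrite -sb sumn_take_le.
rewrite (eq_in_filter (a2 := pred0)) ?filter_pred0 ?cats0; last first.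
  move=> j; rewrite mem_iota add0n => /andP[sj jst].
  suff hb : (b < sumn (take j.+1 (s ++ t)))%N by rewrite /= leqNgt hb.
  have sj' : (j.+1 < size s)%N = false by lia.
  rewrite take_cat sj' sumn_cat sb -[X in (X < _)%N]addn0 ltn_add2l subSn //.
  case: t t0 jst => [|x t] /=; first by rewrite addn0; lia.
  by case/andP=> x0; rewrite addn_gt0 x0.
rewrite -[RHS](mkseq_nth 0%N); apply/eq_in_map => j; rewrite mem_iota add0n => /= js.
by rewrite nth_cat js.
Qed.

Lemma subcomp_cons_S s t b be i :
  is_composition b s -> all (fun x => 0 < x)%N t ->
  subcomp (s ++ t) (b :: be) i.+1 = subcomp t be i.
Proof.
case/andP => s0 /eqP sb t0; rewrite /subcomp /= size_cat iotaD filter_cat map_cat.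
rewrite (eq_in_filter (a2 := pred0)) ?filter_pred0 ?cat0s; last first.
  move=> j; rewrite mem_iota add0n => /= js; rewrite takel_cat; last exact: ltnW.
  have := sumn_take_lt s0 js; rewrite sb; lia.
rewrite add0n -[size s in LHS]addn0 iotaDl filter_map -map_comp.
rewrite (eq_filter (a2 := fun j => (sumn (take i be) <= sumn (take j t))%N && (sumn (take j.+1 t) <= sumn (take i.+1 be))%N)).
  by apply: eq_map => j /=; rewrite nth_cat ltnNge leq_addr /= addKn.
move=> j /=; rewrite -addnS !take_cat !ltnNge !leq_addr /= !addKn !sumn_cat sb.
by rewrite !leq_add2l.
Qed.

Lemma pi2_cat s t b be : is_composition b s -> all (fun x => 0 < x)%N t ->
  pi2 (s ++ t) (b :: be) = (pi1 s * pi2 t be)%N.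
Proof.
move=> hs ht; rewrite /pi2 big_ord_recl subcomp_cons_0 //; congr (_ * _)%N.
by apply: eq_bigr => i _; rewrite subcomp_cons_S.
Qed.

Lemma pi2_neq0 al be : all (fun x => 0 < x)%N al -> pi2 al be != 0%N.
Proof.
move=> al0; rewrite /pi2 -lt0n prodn_gt0 // => i; rewrite lt0n; apply: pi1_neq0.
apply/allP => x /mapP[j]; rewrite mem_filter mem_iota => /andP[_ /= js] ->.
by apply: (allP al0); rewrite mem_nth.
Qed.

(** [psums] omits 0 and the total, which two compositions of [n] share; admitting them makes the
    criterion uniform in [k]. *)
Lemma comp_leP n al be : is_composition n al -> is_composition n be ->
  reflect (forall k, exists l, sumn (take k be) = sumn (take l al)) (comp_le al be).
Proof.
move=> /andP[al0 /eqP sal] /andP[be0 /eqP sbe]; apply: (iffP allP) => h.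
  move=> k; case: (ltnP k (size be)) => kb; last first.
    by exists (size al); rewrite take_size take_oversize // sal.
  case: (posnP k) => [->|k0]; first by exists 0%N; rewrite !take0.
  have: sumn (take k be) \in psums be by apply/mapP; exists k; rewrite // mem_iota; lia.
  by case/h/mapP => l _ ->; exists l.
move=> x /mapP[k]; rewrite mem_iota => hk ->; have [l e] := h k.
have k1 : (0 < sumn (take k be))%N.
  by case: be hk be0 {sbe h e} => [|b be] /=; [lia|]; case: k => [|k] /=; [lia| move=> _ /andP[]; lia].
have k2 : (sumn (take k be) < n)%N by rewrite -sbe; apply: sumn_take_lt => //; lia.
apply/mapP; exists l => //; rewrite mem_iota; apply/andP; split.
  by case: l e => // e; rewrite e take0 in k1.
have : (l < size al)%N; last by lia.
by rewrite ltnNge; apply/negP => hl; move: k2; rewrite e take_oversize // sal ltnn.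
Qed.

Lemma uniq_refinements be : uniq (refinements be).
Proof.
elim: be => //= b be IH; apply: allpairs_uniq => //; first exact: uniq_compositions.
move=> [s t] [s' t'] /= /allpairsP[[s1 t1] /= [h1 _ [-> ->]]] /allpairsP[[s2 t2] /= [h2 _ [-> ->]]].
move: h1 h2; rewrite !mem_compositions => /andP[p1 /eqP e1] /andP[p2 /eqP e2] e.
(* Prefixes of one sequence with positive parts and equal sums have equal length, so the cut is
   determined. *)
have e' : size s1 = size s2.
  wlog lt : s1 s2 t1 t2 p1 e1 p2 e2 e / (size s1 < size s2)%N.
    move=> W; case: (ltngtP (size s1) (size s2)) => // hlt; first exact: (W s1 s2 t1 t2).
    by apply/esym; apply: (W s2 s1 t2 t1).
  have := sumn_take_lt p2 lt; rewrite -(takel_cat t2 (ltnW lt)) -e take_size_cat //.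
  by rewrite e1 e2 ltnn.
by move/eqP: e; rewrite eqseq_cat // => /andP[/eqP -> /eqP ->].
Qed.

Lemma mem_refinements n al be : is_composition n al -> is_composition n be ->
  (al \in refinements be) = comp_le al be.
Proof.
elim: be n al => [|b be IH] n al hal hbe.
  move: hbe hal; rewrite /is_composition /= => /eqP <-; case: al => [|[|a] al] //=; by rewrite andbF.
have sb : sumn (b :: be) = n by case/andP: hbe => _ /eqP.
have sal : sumn al = n by case/andP: hal => _ /eqP.
move: (hbe); rewrite is_composition_cons => /andP[/andP[b0 bn] hbe'].
have al0 : all (fun x => 0 < x)%N al by case/andP: hal.
apply/allpairsP/(comp_leP hal hbe) => [[[s t] /= [hs ht ->]] [|k]|h].
- by exists 0%N; rewrite !take0.
- move: hs; rewrite mem_compositions => /andP[_ /eqP es].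
  have ct : is_composition (n - b) t.
    by rewrite (_ : n - b = sumn be)%N; [exact: refinements_composition | move: sb => /=; lia].
  have /(comp_leP ct hbe') /(_ k) [l e]: comp_le t be by rewrite -(IH _ _ ct hbe').
  exists (size s + l)%N; rewrite /= e take_cat ltnNge leq_addr /= addKn sumn_cat es.
  by [].
(* The partial sum [b] of [b :: be] is attained in [al] after [l] parts; cut there. *)
have [l] := h 1%N; rewrite /= take0 /= addn0 => el.
exists (take l al, drop l al); split; rewrite /= ?cat_take_drop //.
  rewrite mem_compositions /is_composition -el eqxx andbT.
  by apply/allP => x /mem_take /(allP al0).
have ct : is_composition (n - b) (drop l al).
  rewrite /is_composition; apply/andP; split; first by apply/allP => x /mem_drop /(allP al0).
  by have := congr1 sumn (cat_take_drop l al); rewrite sumn_cat -el sal => <-; rewrite addKn.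
rewrite (IH _ _ ct hbe'); apply/(comp_leP ct hbe') => k; have [l' e] := h k.+1.
(* If [l' < l], the truncated difference is 0, and the partial sum of [be] in question is 0 as
   well. *)
exists (l' - l)%N; move: e => /= e.
case: (leqP l l') => ll'.
  apply/(@addnI b); rewrite e {1}el -sumn_cat -{1}(subnKC ll') takeD.
  by [].
have := sumn_take_le (take l al) l'; rewrite take_takel; last exact: ltnW.
by rewrite -e -el (_ : l' - l = 0)%N ?take0 /=; lia.
Qed.

Lemma sum_refinements (V : nmodType) n be (h : seq nat -> V) : is_composition n be ->
  \sum_(al <- refinements be) h al = \sum_(al <- compositions n | comp_le al be) h al.
Proof.
move=> hbe; rewrite -[RHS]big_filter; apply/perm_big/uniq_perm.
- exact: uniq_refinements.
- exact/filter_uniq/uniq_compositions.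
move=> al; rewrite mem_filter mem_compositions.
case: (boolP (is_composition n al)) => hal; first by rewrite (mem_refinements hal hbe) andbT.
rewrite andbF; apply/negP => /refinements_composition.
by case/andP: hbe => _ /eqP ->; apply/negP.
Qed.

Lemma comp_le_refl al : comp_le al al.
Proof. by apply/allP. Qed.

Lemma refinements_size be al : all (fun x => 0 < x)%N be -> al \in refinements be ->
  (size be <= size al)%N /\ (size al = size be -> al = be).
Proof.
elim: be al => [|b be IH] al /=; first by rewrite inE => _ /eqP ->.
case/andP => b0 be0 /allpairsP[[s t] /= [hs /(IH _ be0) [ht1 ht2] ->]].
case: s hs => [|x s]; rewrite mem_compositions; first by rewrite /is_composition /= => /eqP e; rewrite -e in b0.
rewrite /is_composition /= size_cat => hs; split.
  by rewrite ltnS (leq_trans ht1 (leq_addl _ _)).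
case=> e; have s0 : s = [::].
  by apply/size0nil/eqP; rewrite -leqn0 -(leq_add2r (size t)) add0n e.
by move: hs e; rewrite s0 /= addn0 => /andP[_ /eqP ->] /ht2 ->.
Qed.

(* Unitriangularity up to the nonzero factors pi2. *)
Lemma pi2_system_inj n (D : seq nat -> {poly rat}) :
  (forall be, is_composition n be ->
    \sum_(al <- refinements be) D al * ((pi2 al be)%:R^-1)%:P = 0) ->
  forall al, is_composition n al -> D al = 0.
Proof.
(* Downward induction on the number of parts: every other refinement of [be] is strictly longer, so
   only the diagonal term survives. *)
move=> hD al; move: {2}(n - size al)%N (leqnn (n - size al)) => m.
elim: m al => [|m IH] be hm hbe; have := hD be hbe;
  have be0 : all (fun x => 0 < x)%N be by case/andP: hbe.
all: have sbe : sumn be = n by case/andP: hbe => _ /eqP.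
all: have bin : be \in refinements be by rewrite (mem_refinements hbe hbe) comp_le_refl.
all: rewrite (bigD1_seq be) ?uniq_refinements //= big1_seq ?addr0.
all: try by move/eqP; rewrite mulf_eq0 polyC_eq0 invr_eq0 pnatr_eq0 (negbTE (pi2_neq0 _ be0)) orbF => /eqP.
all: move=> al /andP[neq hal]; have := refinements_composition hal; rewrite sbe => cal.
all: have [h1 h2] := refinements_size be0 hal.
all: have lt : (size be < size al)%N by
  rewrite ltn_neqAle h1 andbT eq_sym; apply: contra neq => /eqP/h2 ->.
all: have le : (size al <= n)%N by case/andP: cal => al0 /eqP <-; apply: size_le_sumn.
  by exfalso; lia.
rewrite (IH al) ?mul0r //; move: hm; rewrite !leq_subLR => /leq_trans -> //.
by rewrite addnS -addSn leq_add2r.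
Qed.

(** * Strict colorings counted by peeling off color classes *)

Section StrictColorings.
Variables (T : finType) (r : rel T).

Definition strict_coloring m (R : {set T}) (ka : {ffun T -> 'I_m}) :=
  [forall u in R, forall v in R, r u v ==> (ka u < ka v)%N].

Lemma strict_coloringP m (R : {set T}) (ka : {ffun T -> 'I_m}) :
  reflect (forall u v, u \in R -> v \in R -> r u v -> (ka u < ka v)%N) (strict_coloring R ka).
Proof.
apply: (iffP forall_inP) => [h u v /h /forall_inP h' /h' /implyP //|h u uR].
by apply/forall_inP => v vR; apply/implyP; apply: h.
Qed.

(* Colors are kept in a fixed ['I_m]; a region already peeled off carries
   the dummy color [z], and the remaining colors are at least [c]. *)
Definition coloring_of_content m (z : 'I_m) c (a : seq nat) (R : {set T}) (ka : {ffun T -> 'I_m}) :=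
  [&& [forall v, (v \notin R) ==> (ka v == z)],
      [forall v in R, c <= ka v]%N,
      [forall i : 'I_(size a), #|[set v in R | val (ka v) == (c + i)%N]| == nth 0%N a i]
    & strict_coloring R ka].

(** The class of the least color [c] has no predecessors in [R], so it is closed and independent.
    Conversely, any such set of the right size can receive [c], the rest being colored with larger
    colors. *)
Lemma card_strict_colorings m (z : 'I_m) c a (R : {set T}) : (c + size a)%N = m ->
  (#|[set ka | coloring_of_content z c a R ka]|%:R : rat) = peel r (strict_weight r) a R.
Proof.
elim: a c R => [|b a IH] c R /= cm.
  case: (eqVneq R set0) => [->|/set0Pn[x xR]].
    rewrite (_ : [set ka | _] = [set [ffun=> z]]) ?cards1 //.
    apply/setP => ka; rewrite !inE; apply/and4P/eqP => [[/forallP h _ _ _]|->].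
      by apply/ffunP => v; rewrite ffunE; apply/eqP; move: (h v); rewrite inE.
    split.
    - by apply/forallP => v; rewrite inE ffunE eqxx.
    - by apply/forall_inP => v; rewrite inE.
    - by apply/forallP => -[].
    - by apply/strict_coloringP => u v; rewrite inE.
  rewrite (_ : [set ka | _] = set0) ?cards0 //; apply/setP => ka; rewrite !inE.
  apply/negbTE/negP => /and4P[_ /forall_inP /(_ x xR) h _ _].
  by have := leq_ltn_trans h (ltn_ord (ka x)); rewrite -cm addn0 ltnn.
have cltm : (c < m)%N by lia.
pose cc := Ordinal cltm.
pose first (ka : {ffun T -> 'I_m}) := [set v in R | ka v == cc].
(* [unpeel] and [dopeel] match the colorings of [R :\: A], with [A] at the dummy color, and those of
   [R] with first class [A]. *)
pose unpeel (A : {set T}) (ka : {ffun T -> 'I_m}) := [ffun v => if v \in A then cc else ka v].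
pose dopeel (A : {set T}) (ka : {ffun T -> 'I_m}) := [ffun v => if v \in A then z else ka v].
rewrite -sum1_card natr_sum (partition_big first
  (fun A => [&& A \subset R, pred_closed r R A & #|A| == b])) /=; last first.
  move=> ka; rewrite inE => /and4P[_ /forall_inP hc /forallP hcard /strict_coloringP hs].
  have -> : first ka \subset R by apply/subsetP => v; rewrite inE => /andP[].
  rewrite /=; apply/andP; split.
    apply/pred_closedP => u v uR; rewrite !inE uR => /andP[vR /eqP e] /(hs _ _ uR vR).
    by rewrite e /= => ?; have := hc _ uR; lia.
  have := hcard ord0; rewrite /= addn0 => /eqP <-; apply/eqP; apply: eq_card => v.
  by rewrite !inE.
apply: eq_bigr => A /and3P[AR cA /eqP cardA].
rewrite /strict_weight; case: (boolP (independent r A)) => [iA|niA]; last first.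
  rewrite mul0r big1 // => ka /andP[]; rewrite inE => /and4P[_ _ _ /strict_coloringP hs] /eqP fA.
  case/negP: niA; apply/forall_inP => u uA; apply/forall_inP => v vA; apply/negP => ruv.
  have fc x : x \in A -> ka x = cc by rewrite -fA inE => /andP[_ /eqP].
  by have := hs u v (subsetP AR _ uA) (subsetP AR _ vA) ruv; rewrite !fc // ltnn.
rewrite mul1r -(IH c.+1); last by rewrite -cm addSnnS.
rewrite -sum1_card natr_sum (reindex_onto (unpeel A) (dopeel A)) /=; last first.
  move=> ka /andP[_ /eqP fA]; apply/ffunP => v; rewrite !ffunE.
  by case: ifP => [vA|->] //; apply/esym/eqP; move: vA; rewrite -fA inE => /andP[].
apply: eq_bigl => ka; rewrite !inE.
apply/andP/idP.
  case=> /andP[/and4P[/forallP h1 /forall_inP h2 /forallP h3 /strict_coloringP h4] /eqP fA] /eqP e.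
  have kz v : v \in A -> ka v = z by move=> vA; rewrite -e !ffunE vA.
  have kA v : v \notin A -> unpeel A ka v = ka v by move=> /negbTE vA; rewrite ffunE vA.
  apply/and4P; split.
  - apply/forallP => v; apply/implyP; rewrite inE negb_and negbK.
    case: (boolP (v \in A)) => [/kz -> //|vA /= vR].
    by have := implyP (h1 v) vR; rewrite kA.
  - apply/forall_inP => v; rewrite inE => /andP[vA vR].
    rewrite ltn_neqAle -(kA _ vA) h2 // andbT; apply: contra vA => /eqP ce.
    by rewrite -fA inE vR /=; apply/eqP/val_inj.
  - apply/forallP => i; have /eqP := h3 (lift ord0 i); rewrite /= => <-; apply/eqP/eq_card => v.
    rewrite !inE addnS addSn; case: (boolP (v \in A)) => vA; last by rewrite -(kA _ vA).
    by rewrite ffunE vA /= andbC; apply/esym/negbTE; rewrite negb_and; apply/orP; left; lia.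
  apply/strict_coloringP => u v; rewrite !inE => /andP[uA uR] /andP[vA vR] ruv.
  by rewrite -(kA _ uA) -(kA _ vA); apply: h4.
case/and4P => [/forallP h1 /forall_inP h2 /forallP h3 /strict_coloringP h4].
have kz v : v \in A -> ka v = z.
  by move=> vA; apply/eqP; apply: (implyP (h1 v)); rewrite inE vA.
have kA v : v \notin A -> unpeel A ka v = ka v by move=> /negbTE vA; rewrite ffunE vA.
have kc v : v \in A -> unpeel A ka v = cc by move=> vA; rewrite ffunE vA.
have gtc v : v \in R -> v \notin A -> (c < ka v)%N by move=> vR vA; apply: h2; rewrite inE vA.
have fA : first (unpeel A ka) = A.
  apply/setP => v; rewrite inE; case: (boolP (v \in A)) => vA.
    by rewrite kc // eqxx (subsetP AR).
  apply/negP => /andP[vR]; rewrite kA // => /eqP e.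
  by have := gtc v vR vA; rewrite e ltnn.
split; last by apply/eqP/ffunP => v; rewrite !ffunE; case: ifP => [vA|->] //; rewrite kz.
rewrite fA eqxx andbT; apply/and4P; split.
- apply/forallP => v; apply/implyP => vR; have vA : v \notin A by apply: contra vR; apply: (subsetP AR).
  by rewrite kA //; apply: (implyP (h1 v)); rewrite inE negb_and vR orbT.
- apply/forall_inP => v vR; case: (boolP (v \in A)) => vA; first by rewrite kc.
  by rewrite kA //; apply: ltnW; apply: gtc.
- apply/forallP => i; case: (unliftP ord0 i) => [j|] ->.
    have /eqP := h3 j; rewrite /= => <-; apply/eqP/eq_card => v.
    rewrite !inE addnS addSn; case: (boolP (v \in A)) => vA; last by rewrite (kA _ vA).
    by rewrite kc //= andbC; apply/negbTE; rewrite negb_and; apply/orP; left; lia.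
  rewrite /= addn0 -cardA -{2}fA; apply/eqP/eq_card => v; by rewrite !inE.
apply/strict_coloringP => u v uR vR ruv.
(* An edge into [A] would have its tail in [A] by closure, which independence forbids. *)
case: (boolP (v \in A)) => vA.
  have uA := pred_closedP _ _ _ cA u v uR vA ruv.
  by move: iA => /forall_inP/(_ u uA)/forall_inP/(_ v vA); rewrite ruv.
rewrite (kA _ vA); case: (boolP (u \in A)) => uA; first by rewrite kc //= gtc.
by rewrite kA //; apply: h4; rewrite // inE ?uA ?vA.
Qed.

Lemma strict_coloring_acyclic m (ka : {ffun T -> 'I_m}) :
  strict_coloring [set: T] ka -> acyclic r.
Proof.
move/strict_coloringP => h; apply/forallP => R; apply/implyP => /set0Pn[x xR].
apply/exists_inP; case: (arg_minnP (fun v => val (ka v)) xR) => v vR hv; exists v => //.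
by apply/forall_inP => u uR; apply/negP => /h; rewrite !inE ltnNge hv // => /(_ isT isT).
Qed.

End StrictColorings.

(** * Closure properties of N[q] *)

Definition nat_coefs (p : {poly rat}) := forall i, exists m : nat, p`_i = m%:R.

Lemma nat_coefsD p q : nat_coefs p -> nat_coefs q -> nat_coefs (p + q).
Proof. by move=> hp hq i; have [m em] := hp i; have [k ek] := hq i; exists (m + k)%N; rewrite coefD em ek natrD. Qed.

Lemma nat_coefsXM p : nat_coefs p -> nat_coefs ('X * p).
Proof. by move=> hp [|i]; rewrite coefXM /=; [exists 0%N | exact: hp]. Qed.

Lemma nat_coefsC m : nat_coefs (m%:R)%:P.
Proof. by case=> [|i]; rewrite coefC; [exists m | exists 0%N]. Qed.

Lemma peel_gen_weight_nat (T : finType) (r : rel T) s (R : {set T}) :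
  exists m : nat, peel r (gen_weight r) s R = m%:R.
Proof.
elim: s R => [|a s IH] R /=; first by exists (R == set0).
elim/big_ind: _ => [|_ _ [m ->] [k ->]|A _]; first by exists 0%N.
  by exists (m + k)%N; rewrite natrD.
have [m ->] := IH (R :\: A); rewrite /gen_weight -natrM.
by exists (#|[set x | generates r A x]| * m)%N.
Qed.

(** * The LLT series at q + 1 and its positive expansion *)

Section ShiftedLLT.
Variable n : nat.
Implicit Types (E S : seq ('I_n * 'I_n)) (a al be : seq nat).

Definition has_content (a : seq nat) (ka : {ffun 'I_n -> 'I_(size a)}) :=
  [forall i : 'I_(size a), #|[set v | ka v == i]| == nth 0%N a i].

(* The series of (S, E) after the substitution q |-> q + 1, with E the
   edges outside S: each ascent contributes the factor 1 + q. *)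
Definition shiftedLLT S E a : {poly rat} :=
  \sum_(ka : {ffun 'I_n -> 'I_(size a)} |
         has_content ka && all (fun e => ka e.1 < ka e.2)%N S)
     \prod_(e <- E) (1 + 'X *+ (ka e.1 < ka e.2)%N).

(** In the factor of [e], the term 1 leaves [e] free, while the term q occurs only if [e] is an
    ascent and so makes [e] a strict edge. *)
Lemma shiftedLLT_cons S e E a :
  shiftedLLT S (e :: E) a = shiftedLLT S E a + 'X * shiftedLLT (e :: S) E a.
Proof.
rewrite /shiftedLLT mulr_sumr [X in _ + X]big_mkcond [X in X + _]big_mkcond /= -big_split /=.
rewrite [LHS]big_mkcond; apply: eq_bigr => ka _; rewrite big_cons.
case: has_content => /=; last by rewrite addr0.
case: (all _ S); rewrite ?andbF ?addr0 // andbT.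
by case: (_ < _)%N; rewrite ?mulr1n ?mulr0n ?mulrDl ?mul1r ?mul0r ?addr0.
Qed.

Lemma LLTcoef_shift S E E' a : perm_eq E (S ++ E') ->
  LLTcoef E S a \Po ('X + 1) = shiftedLLT S E' a.
Proof.
move=> pE; rewrite /LLTcoef raddf_sum; apply: eq_bigr => ka /andP[_ allS].
(* All edges of [S] are ascents, so the exponent counts exactly the ascents in [E']. *)
rewrite /= comp_Xn_poly /asc (permP pE) count_cat ; move: allS; rewrite all_count => /eqP ->.
rewrite addKn; elim: E' {pE} => [|e E' IH] /=; first by rewrite big_nil expr0.
rewrite big_cons -IH exprD; congr (_ * _).
by case: (_ < _)%N; rewrite ?expr1 ?expr0 ?mulr1n ?mulr0n ?addr0 // addrC.
Qed.

Definition edge_rel S : rel 'I_n := fun u v => (u, v) \in S.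

Lemma shiftedLLT_nil S a : is_composition n a ->
  shiftedLLT S [::] a =
    (peel (edge_rel S) (strict_weight (edge_rel S)) a [set: 'I_n])%:P.
Proof.
rewrite /shiftedLLT; under eq_bigr do rewrite big_nil.
rewrite -(rmorph1 (@polyC _)) -raddf_sum => ca; congr _%:P.
(* An empty content offers no dummy color; then [n = 0] and there is one coloring. *)
case: a ca => [|b a] ca.
  have n0 : n = 0%N by case/andP: ca => _ /eqP.
  rewrite (eq_bigl xpredT) => [|ka].
    rewrite sumr_const card_ffun !card_ord {1}n0 expn0 /= (_ : _ == _) //.
    by apply/eqP/setP => v; have := ltn_ord v; rewrite {2}n0.
  apply/andP; split; first by apply/forallP => -[].
  by apply/allP => -[u v]; have := ltn_ord u; rewrite {2}n0.
rewrite -(@card_strict_colorings _ _ _ (@ord0 (size a)) 0) // -sum1_card natr_sum.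
apply: eq_bigl => ka; rewrite inE; apply/andP/and4P => [[/forallP h1 /allP h2]|[_ _ /forallP h3 /strict_coloringP h4]].
  split.
  - by apply/forallP => v; rewrite inE.
  - by apply/forall_inP.
  - apply/forallP => i; have /eqP <- := h1 i; apply/eqP/eq_card => v.
    by rewrite !inE add0n.
  - by apply/strict_coloringP => u v _ _ /h2.
split; last by apply/allP => -[u v] uv; apply: h4; rewrite ?inE.
apply/forallP => i; have /eqP <- := h3 i; apply/eqP/eq_card => v.
by rewrite !inE add0n.
Qed.

(** In the acyclic case both sides equal the peeling count with all weights 1, reached from the left
    by the signed strict weights and from the right by the generator weights. *)
Lemma strict_part_positive S : exists2 C : seq nat -> {poly rat},
  (forall al, nat_coefs (C al)) &
  forall be, is_composition n be ->
    \sum_(al <- refinements be) (sign_of al)%:P * shiftedLLT S [::] (rev al) =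
    \sum_(al <- refinements be) C al * ((pi2 al be)%:R^-1)%:P.
Proof.
set r := edge_rel S.
case: (boolP (acyclic r)) => acy; last first.
  exists (fun=> 0) => [al|be hbe]; first exact: (nat_coefsC 0).
  rewrite [RHS]big1 ?big1 // => [al _|al _]; last by rewrite mul0r.
  rewrite /shiftedLLT big1 ?mulr0 // => ka /andP[_ /allP hS]; case/negP: acy.
  by apply: (strict_coloring_acyclic (ka := ka)); apply/strict_coloringP => u v _ _ /hS.
(* The number of ordered partitions of the vertices with block sizes [rev al], each block closed in
   what remains and given a chosen generator. *)
exists (fun al => (peel r (gen_weight r) (rev al) [set: 'I_n])%:P).
  by move=> al; have [m ->] := peel_gen_weight_nat r (rev al) [set: 'I_n]; apply: nat_coefsC.
move=> be hbe; have be0 : all (fun x => 0 < x)%N be by case/andP: hbe.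
have sbe : sumn be = n by case/andP: hbe => _ /eqP.
have cardT : #|[set: 'I_n]| = sumn be by rewrite cardsT card_ord.
transitivity ((peel r (fun=> 1) (rev be) [set: 'I_n])%:P); last first.
  rewrite -(@sum_refinements_peel _ r (gen_weight r) (fun s => (pi1 s)%:R^-1)
    (gen_weight_sum1 r) (fun be al => (pi2 al be)%:R^-1)) //.
  - by rewrite raddf_sum; apply: eq_bigr => al _; rewrite /= polyCM mulrC.
  - by rewrite /pi2 big_ord0 invr1.
  move=> b be' s t; rewrite mem_compositions => hs /refinements_composition /andP[ht _].
  by rewrite pi2_cat // natrM invfM.
rewrite -(@sum_refinements_peel _ r (strict_weight r) sign_of (strict_weight_sum1 acy) (fun _ => sign_of)) //.
  rewrite raddf_sum big_seq [RHS]big_seq; apply: eq_bigr => al /refinements_composition.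
  by rewrite sbe => hal; rewrite shiftedLLT_nil ?is_composition_rev //= polyCM.
by move=> b be' s t _ _; apply: sign_of_cat.
Qed.

Lemma shiftedLLT_positive E S : exists2 C : seq nat -> {poly rat},
  (forall al, nat_coefs (C al)) &
  forall be, is_composition n be ->
    \sum_(al <- refinements be) (sign_of al)%:P * shiftedLLT S E (rev al) =
    \sum_(al <- refinements be) C al * ((pi2 al be)%:R^-1)%:P.
Proof.
elim: E S => [|e E IH] S; first exact: strict_part_positive.
have [C1 p1 e1] := IH S; have [C2 p2 e2] := IH (e :: S).
exists (fun al => C1 al + 'X * C2 al) => [al|be hbe].
  by apply: nat_coefsD => //; apply: nat_coefsXM.
under [RHS]eq_bigr => al _ do rewrite mulrDl -mulrA.
rewrite big_split /= -mulr_sumr -e1 // -e2 // mulr_sumr -big_split /=.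
by apply: eq_bigr => al _; rewrite shiftedLLT_cons mulrDr mulrCA.
Qed.

Lemma Psicoef_composition al be : is_composition n al -> is_composition n be ->
  Psicoef n al be / (zee al)%:R = (comp_le al be)%:R / (pi2 al be)%:R.
Proof.
case/andP => al0 _ hbe; have be0 : all (fun x => 0 < x)%N be by case/andP: hbe.
have z0 : ((zee al)%:R : rat) != 0.
  rewrite pnatr_eq0 -lt0n prodn_cond_gt0 // => i _.
  rewrite muln_gt0 fact_gt0 andbT expn_gt0; case: posnP => //= ->.
  by apply/eqP/count_memPn/negP => /(allP al0).
rewrite /Psicoef mulrAC divff // mul1r big_mkcond (bigD1_seq be) ?uniq_compositions ?mem_compositions //=.
rewrite big1 ?addr0 => [|be' /negPf ne]; rewrite /Mcoef (all_filterP _).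
- by case: comp_le; rewrite ?eqxx ?mulr1 ?mul1r ?mul0r.
- by apply: sub_all be0 => x; rewrite lt0n.
- by rewrite eq_sym ne mulr0 if_same.
by apply: sub_all be0 => x; rewrite lt0n.
Qed.

End ShiftedLLT.

(** * Identification of the coefficients *)

Lemma count_sub_perm (T : eqType) (S E : seq T) :
  (forall e, (count_mem e S <= count_mem e E)%N) -> exists E', perm_eq E (S ++ E').
Proof.
elim: S E => [|e S IH] E h; first by exists E.
have eE : e \in E by have := h e; rewrite /= eqxx -has_pred1 has_count; lia.
have pE := perm_to_rem eE.
have [E' pE'] : exists E', perm_eq (rem e E) (S ++ E').
  by apply: IH => x; have := h x; rewrite (permP pE) /=; lia.
by exists E'; rewrite (perm_trans pE) //= perm_cons.
Qed.

Theorem theorem7p9 (n : nat) (E S : seq ('I_n * 'I_n))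
  (hS : forall e, (count_mem e S <= count_mem e E)%N)
  (d : {set 'I_(n.-1)} -> {poly rat}) (c : seq nat -> {poly rat}) :
  (* G_{G,S}(x; q+1) = sum_T d_T F_{n,T} *)
  (forall a : seq nat,
     (LLTcoef E S a) \Po ('X + 1) = \sum_(T : {set 'I_(n.-1)}) d T * (Fcoef T a)%:P) ->
  (* omega G_{G,S}(x; q+1) = sum_{alpha |= n} c_alpha Psi_alpha / z_alpha *)
  (forall a : seq nat,
     \sum_(T : {set 'I_(n.-1)}) d T * (Fcoef (omega_set T) a)%:P =
     \sum_(al <- compositions n) c al * (Psicoef n al a / (zee al)%:R)%:P) ->
  forall al : seq nat, is_composition n al ->
    forall i : nat, exists m : nat, (c al)`_i = m%:R.
Proof.
move=> hF hPsi al hal i.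
have [E' pE] := count_sub_perm hS.
have [C natC hC] := shiftedLLT_positive E' S.
suff -> : c al = C al by apply: natC.
apply/eqP; rewrite -subr_eq0; apply/eqP.
(* Both families solve the triangular system given by the coefficients of M_be in omega G, so they
   agree. *)
move: al hal; apply: (@pi2_system_inj n (fun al => c al - C al)) => be hbe.
under eq_bigr => al _ do rewrite mulrBl.
rewrite sumrB -hC //; apply/eqP; rewrite subr_eq0; apply/eqP.
transitivity (\sum_(al <- compositions n) c al * (Psicoef n al be / (zee al)%:R)%:P).
  rewrite (sum_refinements _ hbe) big_mkcond big_seq [RHS]big_seq; apply: eq_bigr => al.
  rewrite mem_compositions => hal; rewrite Psicoef_composition //.
  by case: comp_le; rewrite ?mul1r ?mul0r ?mulr0.
(* On coefficients omega is the signed sum over refinements; [hF] at [rev al] then identifies each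
   term with [shiftedLLT]. *)
rewrite -hPsi; under eq_bigr => T _ do rewrite Fcoef_omega // raddf_sum mulr_sumr.
rewrite exchange_big /=; apply: eq_bigr => al _.
rewrite -(LLTcoef_shift _ pE) hF mulr_sumr; apply: eq_bigr => T _.
by rewrite polyCM mulrCA.
Qed.
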